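(* Let $G$ be an interval graph with $n \ge 3$ vertices and no isolated vertices, given by an intersection model with sorted endpoints (as described in the context). Consider the following greedy procedure (Algorithm 1): start with $S=\emptyset$; as long as some vertex of $G$ is neither in $S$ nor adjacent to a vertex of $S$, let $v$ be the next undominated vertex with respect to $S$ and replace $S$ by $S\cup\{p(v),p(p(v))\}$; finally output $S$. Then Algorithm 1 outputs a minimum paired-dominating set of $G$, and it can be implemented to run in $O(n)$ time.
   Context: For a graph $G$, a set $S\subseteq V(G)$ is a dominating set if every vertex not in $S$ is adjacent to a vertex of $S$; it is a paired-dominating set if it is dominating and the induced subgraph $G[S]$ has a perfect matching. A minimum paired-dominating set is one of smallest cardinality. An interval graph $G$ with $V(G)=\{v_1,\dots,v_n\}$ is given by an intersection model: each vertex $v$ corresponds to a closed interval $a(v)=[\ell(v),r(v)]$ on the real line, and two vertices are adjacent iff their intervals intersect. All $2n$ endpoints are distinct and are labelled by the integers $1,\dots,2n$ in increasing left-to-right order (''sorted endpoints''), and vertices are indexed so that $\ell(v_1)<\ell(v_2)<\dots<\ell(v_n)$. $N_G(v)$ is the set of neighbours of $v$. The partner $p(v)$ of $v$ is the neighbour $u\in N_G(v)$ whose right endpoint $r(u)$ is largest among all neighbours of $v$. For $S\subseteq V(G)$, the next undominated vertex with respect to $S$ is, among the vertices that are neither in $S$ nor adjacent to a vertex of $S$, the one whose interval has the leftmost right endpoint. *)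

(* Defs.v *)
From Stdlib Require Import Rdefinitions Raxioms.
From mathcomp Require Import all_boot.

Set Implicit Arguments.
Unset Strict Implicit.
Unset Printing Implicit Defensive.

(* A graph on a finite type T is given by its adjacency relation e : rel T.
   For interval graphs e is forced to be symmetric and irreflexive by
   interval_model below. *)
Section Graphs.
Variables (T : finType) (e : rel T).

Definition dominating (S : {set T}) : bool :=
  [forall v, (v \notin S) ==> [exists u in S, e v u]].

Definition induced_edges (S : {set T}) : {set {set T}} :=
  [set [set u; v] | u in S, v in S & e u v].

Definition perfect_matching (S : {set T}) (M : {set {set T}}) : bool :=
  [&& M \subset induced_edges S, trivIset M & cover M == S].

Definition paired_dominating (S : {set T}) : bool :=
  dominating S && [exists M, perfect_matching S M].

Definition minimum_paired_dominating (S : {set T}) : Prop :=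
  paired_dominating S /\
  forall S' : {set T}, paired_dominating S' -> #|S| <= #|S'|.

Definition no_isolated_vertex : Prop := forall v, exists u, e v u.

Definition undominated (S : {set T}) : {set T} :=
  [set v | (v \notin S) && [forall u in S, ~~ e v u]].

Variable r : T -> nat.

(* If v has no neighbour, the value is the dummy v. *)
Definition partner (v : T) : T := [arg max_(u > v | e v u) r u].

Definition next_undominated (S : {set T}) (v : T) : Prop :=
  v \in undominated S /\ forall w, w \in undominated S -> r v <= r w.

(* greedy_run S S' : the while loop, entered with current set S, terminates
   with current set S'. *)
Inductive greedy_run : {set T} -> {set T} -> Prop :=
| Greedy_stop S : undominated S = set0 -> greedy_run S S
| Greedy_step S v S' :
    next_undominated S v ->
    greedy_run (S :|: [set partner v; partner (partner v)]) S' ->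
    greedy_run S S'.

Definition greedy_outputs (S : {set T}) : Prop := greedy_run set0 S.

End Graphs.

Definition in_interval (a b : nat) (x : R) : Prop :=
  Rle (INR a) x /\ Rle x (INR b).

(* The vertex v_(i+1) is i : 'I_n, and its interval is [l i, r i].  The second
   clause says that the 2n endpoints are distinct and are exactly 1, ..., 2n. *)
Definition interval_model (n : nat) (e : rel 'I_n) (l r : 'I_n -> nat) : Prop :=
  [/\ forall v, l v < r v,
      perm_eq ([seq l v | v <- enum 'I_n] ++ [seq r v | v <- enum 'I_n])
              (iota 1 (2 * n)),
      forall u v : 'I_n, u < v -> l u < l v
    & forall u v : 'I_n, e u v <->
        u <> v /\ exists x : R,
          in_interval (l u) (r u) x /\ in_interval (l v) (r v) x].

(* Running time is measured on a unit-cost RAM, presented as a structured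
   language with scalar variables and arrays of natural numbers, both named by
   natural numbers; an array cell is reached in one step by indirect
   addressing.  The only arithmetic operations are successor and predecessor,
   so in t steps no number exceeds the largest input number (or program
   constant) by more than t: unit cost cannot be abused by computing with huge
   numbers, and a linear bound here gives a linear bound on any RAM with words
   of O(log n) bits. *)
Inductive exp :=
| Const of nat
| Var of nat
| Read of nat & exp
| Succ of exp
| Pred of exp.

Inductive test :=
| Less of exp & exp
| Equal of exp & exp.

Inductive cmd :=
| Skip
| Assign of nat & exp
| Store of nat & exp & exp
| Seq of cmd & cmd
| If of test & cmd & cmd
| While of test & cmd.

Record state := State { vars : nat -> nat; arrays : nat -> nat -> nat }.

Definition set_var (s : state) (x k : nat) : state :=
  State (fun y => if y == x then k else vars s y) (arrays s).

Definition set_cell (s : state) (a i k : nat) : state :=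
  State (vars s)
        (fun b j => if (b == a) && (j == i) then k else arrays s b j).

Fixpoint eval (s : state) (E : exp) : nat :=
  match E with
  | Const k => k
  | Var x => vars s x
  | Read a E1 => arrays s a (eval s E1)
  | Succ E1 => (eval s E1).+1
  | Pred E1 => (eval s E1).-1
  end.

Definition holds (s : state) (B : test) : bool :=
  match B with
  | Less E1 E2 => eval s E1 < eval s E2
  | Equal E1 E2 => eval s E1 == eval s E2
  end.

Fixpoint exp_cost (E : exp) : nat :=
  match E with
  | Const _ | Var _ => 1
  | Read _ E1 | Succ E1 | Pred E1 => (exp_cost E1).+1
  end.

Definition test_cost (B : test) : nat :=
  match B with
  | Less E1 E2 | Equal E1 E2 => (exp_cost E1 + exp_cost E2).+1
  end.

(* exec C s t s' : started in s, C halts in state s' after t steps. *)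
Inductive exec : cmd -> state -> nat -> state -> Prop :=
| Exec_skip s : exec Skip s 1 s
| Exec_assign s x E :
    exec (Assign x E) s (exp_cost E).+1 (set_var s x (eval s E))
| Exec_store s a E1 E2 :
    exec (Store a E1 E2) s (exp_cost E1 + exp_cost E2).+1
         (set_cell s a (eval s E1) (eval s E2))
| Exec_seq C1 C2 s1 t1 s2 t2 s3 :
    exec C1 s1 t1 s2 -> exec C2 s2 t2 s3 -> exec (Seq C1 C2) s1 (t1 + t2) s3
| Exec_if_true B C1 C2 s t s' :
    holds s B -> exec C1 s t s' -> exec (If B C1 C2) s (test_cost B + t) s'
| Exec_if_false B C1 C2 s t s' :
    ~~ holds s B -> exec C2 s t s' -> exec (If B C1 C2) s (test_cost B + t) s'
| Exec_while_true B C s1 t1 s2 t2 s3 :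
    holds s1 B -> exec C s1 t1 s2 -> exec (While B C) s2 t2 s3 ->
    exec (While B C) s1 (test_cost B + t1 + t2) s3
| Exec_while_false B C s :
    ~~ holds s B -> exec (While B C) s (test_cost B) s.

Definition table (n : nat) (f : 'I_n -> nat) (i : nat) : nat :=
  if insub i is Some v then f v else 0.

(* Variable 0 holds n, array 0 the left and array 1 the right endpoints;
   everything else is 0. *)
Definition input_state (n : nat) (l r : 'I_n -> nat) : state :=
  State (fun x => if x == 0 then n else 0)
        (fun a => match a with
                  | 0 => table l
                  | 1 => table r
                  | _ => fun=> 0
                  end).

(* The output set is returned as its characteristic vector, in array 2. *)
Definition output_is (n : nat) (s : state) (S : {set 'I_n}) : Prop :=
  forall v : 'I_n, arrays s 2 v = (v \in S).

Definition computes_within (C : cmd) (n : nat) (l r : 'I_n -> nat)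
    (time : nat) (S : {set 'I_n}) : Prop :=
  exists (t : nat) (s : state),
    [/\ exec C (input_state l r) t s, t <= time & output_is s S].

(* Main.v *)
(* Optimality.  Let v be a vertex chosen by the algorithm and w one chosen later.
   Since w is not adjacent to p(v) or p(p(v)), both of these intervals, and v
   itself, lie entirely to the left of w; as p and p(p) reach as far right as
   possible, no edge has one end in N[v] and the other in N[w].  So in any
   paired-dominating set the chosen vertices are dominated by distinct matching
   edges, while the algorithm spends exactly one matching edge on each of them.

   Linear time.  Two sweeps over the 2n endpoints suffice.  The first keeps the
   two largest right endpoints b2 < b1 among the intervals opened so far; when v
   closes, r(p(v)) is b1, or b2 if b1 = r(v).  The second meets the vertices by
   increasing right endpoint; since the current set S lies to the left of every
   undominated vertex, v is undominated iff max r(S) < l(v), so it is enough to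
   maintain that maximum. *)

From Stdlib Require Import RIneq.
Require Import Defs.
From mathcomp Require Import all_boot zify.

Set Implicit Arguments.
Unset Strict Implicit.
Unset Printing Implicit Defensive.

(** * Maximality of the partner *)

(* arg_maxnP needs a default value that satisfies P, whereas the default v in
   the definition of partner is not a neighbour of v. *)
Lemma arg_max_default (I : finType) (P : pred I) (F : I -> nat) (i j : I) :
  P j -> arg_max i P F = arg_max j P F.
Proof.
move=> Pj.
have [k Pk maxk] : exists2 k, P k & forall m, P m -> F m <= F k.
  by case: (arg_maxnP F Pj) => k; exists k.
rewrite /arg_max /extremum; case: pickP => // /(_ k) /=.
by rewrite Pk => /negP[]; apply/forall_inP.
Qed.

Lemma partnerP (T : finType) (e : rel T) (r : T -> nat) (v u : T) :
  e v u -> e v (partner e r v) /\ forall w, e v w -> r w <= r (partner e r v).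
Proof.
by move=> evu; rewrite /partner (arg_max_default _ _ evu); case: arg_maxnP.
Qed.

(** * Lower bound on the size of paired-dominating sets *)

Section LowerBound.
Variables (T : finType) (e : rel T).
Hypothesis e_sym : symmetric e.
Hypothesis e_irr : irreflexive e.

Definition near (u v : T) := (u == v) || e u v.

Lemma near_sym u v : near u v = near v u.
Proof. by rewrite /near eq_sym e_sym. Qed.

(** Pairwise distance at least 4: two closed neighbourhoods share no vertex and no edge joins
    them. *)
Definition separated (W : {set T}) :=
  {in W &, forall v w, v != w ->
     forall x y, near v x -> near w y -> ~~ near x y}.

Lemma in_undominated (S : {set T}) v :
  (v \in undominated e S) = [forall u in S, ~~ near v u].
Proof.
rewrite inE; apply/andP/forall_inP => [[vS /forall_inP far] u uS | far].
  rewrite negb_or far // andbT; apply: contraNneq vS => ->; exact: uS.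
split; last by apply/forall_inP => u /far; rewrite negb_or => /andP[].
by apply/negP => /far; rewrite /near eqxx.
Qed.

Lemma dominatingE (S : {set T}) : dominating e S = (undominated e S == set0).
Proof.
apply/forallP/eqP => [dom | und0 v].
  apply/setP => v; rewrite inE in_set0; apply/negP => /andP[vS /forall_inP far].
  have /exists_inP[u uS evu] := implyP (dom v) vS.
  by move: (far u uS); rewrite evu.
apply/implyP => vS; move/setP/(_ v): und0; rewrite inE in_set0 vS /=.
by move/negbT; rewrite negb_forall_in => /exists_inP[u uS /negPn evu];
  apply/exists_inP; exists u.
Qed.

Lemma card_perfect_matching (S : {set T}) (M : {set {set T}}) :
  perfect_matching e S M -> #|S| = #|M| * 2.
Proof.
case/and3P=> /subsetP MS tM /eqP covM.
have card2 A : A \in M -> #|A| = 2.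
  move=> /MS /imset2P[u v uS]; rewrite !inE => /andP[vS euv] ->.
  by rewrite cards2; case: eqVneq euv => // ->; rewrite e_irr.
apply: (@card_uniform_partition _ 2 M S) => [A /card2 //|].
rewrite /partition covM eqxx tM /=; apply/negP => /card2.
by rewrite cards0.
Qed.

(* Distinct members of W are dominated through distinct matching edges. *)
Lemma separated_card (W S : {set T}) :
  separated W -> paired_dominating e S -> 2 * #|W| <= #|S|.
Proof.
move=> sepW /andP[]; rewrite dominatingE => /eqP und0 /existsP[M perfM].
rewrite (card_perfect_matching perfM) mulnC leq_mul2r /=.
have /and3P[/subsetP MS tM /eqP covM] := perfM.
have /fin_all_exists2[x xS near_x] v : exists2 x, x \in S & near v x.
  move/setP/(_ v): und0; rewrite in_undominated in_set0.
  by move/negbT; rewrite negb_forall_in => /exists_inP[u uS /negPn]; exists u.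
pose B v := pblock M (x v).
have B_inj : {in W &, injective B}.
  move=> v w vW wW eqB; apply/eqP/negPn/negP => neq_vw.
  move/negP: (sepW v w vW wW neq_vw _ _ (near_x v) (near_x w)); apply.
  have xvM : x v \in cover M by rewrite covM.
  have xwM : x w \in cover M by rewrite covM.
  (* If both blocks are one edge with ends [a] and [b], then [x v] and [x w] are among these ends,
     hence equal or adjacent. *)
  have := pblock_mem xvM; move/MS/imset2P=> [a b aS].
  rewrite !inE => /andP[bS eab] BvE.
  have := xvM; rewrite -mem_pblock BvE !inE => xv.
  have := xwM; rewrite -mem_pblock -/(B w) -eqB /B BvE !inE => xw.
  rewrite /near; case/orP: xv => /eqP->; case/orP: xw => /eqP->;
    by rewrite ?eqxx ?eab ?(e_sym b a) ?eab ?orbT.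
rewrite -(card_in_imset B_inj); apply/subset_leq_card/subsetP => _ /imsetP[v vW ->].
by rewrite pblock_mem // covM.
Qed.

End LowerBound.

(** * Optimality and termination of the greedy procedure *)

Section Greedy.
Variables (T : finType) (e : rel T) (l r : T -> nat).
Hypothesis lt_lr : forall v, l v < r v.
Hypothesis edgeE : forall u v, e u v = [&& u != v, l u <= r v & l v <= r u].
Hypothesis noniso : no_isolated_vertex e.

Local Notation p := (partner e r).
Local Notation pair v := [set p v; p (p v)].

Lemma edge_sym : symmetric e.
Proof. by move=> u v; rewrite !edgeE eq_sym [X in _ && X]andbC. Qed.

Lemma edge_irr : irreflexive e.
Proof. by move=> v; rewrite edgeE eqxx. Qed.

Lemma nearE u v : near e u v = (l u <= r v) && (l v <= r u).
Proof. by rewrite /near edgeE; case: eqVneq => //= ->; rewrite ltnW. Qed.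

Lemma edge_partner v : e v (p v).
Proof. by have [u evu] := noniso v; have [] := partnerP r evu. Qed.

Lemma le_partner v u : e v u -> r u <= r (p v).
Proof. by move=> evu; have [_] := partnerP r evu; apply. Qed.

Lemma near_partner v : near e v (p v).
Proof. by rewrite /near edge_partner orbT. Qed.

(** [v] itself competes for the role of [p (p v)]. *)
Lemma le_partner2 v : r v <= r (p (p v)).
Proof. by apply: le_partner; rewrite edge_sym edge_partner. Qed.

(** Loop invariant of the greedy procedure; it reduces the undominated test to a comparison of
    endpoints. *)
Definition left_of_undominated (X : {set T}) :=
  forall v u, v \in undominated e X -> u \in X -> r u < l v.

Lemma undominatedE X v : left_of_undominated X ->
  (v \in undominated e X) = [forall u in X, r u < l v].
Proof.
move=> leftX; apply/idP/forall_inP => [vX u | left]; first exact: leftX.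
rewrite in_undominated; apply/forall_inP => u /left lt_uv.
by rewrite nearE leqNgt lt_uv.
Qed.

Lemma undominatedU (X Y : {set T}) v :
  v \in undominated e (X :|: Y) =
  (v \in undominated e X) && (v \in undominated e Y).
Proof.
rewrite !in_undominated; apply/forall_inP/andP => [far | [/forall_inP fX /forall_inP fY]].
  by split; apply/forall_inP => u uX; apply: far; rewrite inE uX ?orbT.
by move=> u /setUP[/fX|/fY].
Qed.

(** [p v] starts by [r v <= r w] and misses [w], so it ends before [w]; [p (p v)] starts by
    [r (p v)] and misses [w], so it does too, and [v] ends no later than [p (p v)]. *)
Lemma next_far X v w :
  next_undominated e r X v -> w \in undominated e (X :|: pair v) ->
  [/\ r v < l w, r (p v) < l w & r (p (p v)) < l w].
Proof.
case=> _ min_v; rewrite undominatedU => /andP[/min_v le_vw].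
rewrite in_undominated => /forall_inP far.
have := far (p v); rewrite !inE eqxx => /(_ isT).
have := far (p (p v)); rewrite !inE eqxx orbT => /(_ isT).
have := near_partner v; have := near_partner (p v); rewrite !nearE.
by move: (le_partner2 v) (lt_lr w) => *; split; lia.
Qed.

Lemma left_of_undominated_step X v :
  left_of_undominated X -> next_undominated e r X v ->
  left_of_undominated (X :|: pair v).
Proof.
move=> leftX next w u wX'; have [_ far far2] := next_far next wX'.
move: wX'; rewrite undominatedU => /andP[wX _].
by case/setUP => [|/set2P[]->] //; apply: leftX.
Qed.

Lemma next_dominated X v :
  v \notin undominated e (X :|: pair v).
Proof.
rewrite in_undominated; apply/forall_inPn; exists (p v).
  by rewrite !inE eqxx orbT.
by rewrite negbK near_partner.
Qed.

(** Both partners reach at least [l v], whereas [X] ends before it. This keeps the matching edges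
    disjoint. *)
Lemma pair_fresh X v :
  left_of_undominated X -> v \in undominated e X -> [disjoint X & pair v].
Proof.
move=> leftX vX; rewrite disjoint_sym disjoints_subset.
apply/subsetP => u; rewrite !inE => /orP[]/eqP ->; apply/negP => /(leftX _ _ vX).
  by have := near_partner v; rewrite nearE; lia.
by have := le_partner2 v; have := lt_lr v; lia.
Qed.

(* A neighbour y of a neighbour of v either meets p v, and then reaches no
   further than p (p v), or ends before p v starts. *)
Lemma next_separated X v w x y :
  next_undominated e r X v -> w \in undominated e (X :|: pair v) ->
  near e v x -> near e w y -> ~~ near e x y.
Proof.
move=> next /(next_far next)[farv farp farpp] vx wy.
(* [v] may reach further than [p v], hence the separate case. Any other [x] ends by [r (p v)], so a
   [y] that meets both [x] and [w] must meet [p v]. *)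
have x_le : r x <= r (p v) \/ x = v.
  by case/orP: vx => [/eqP<-|/le_partner]; [right | left].
have y_le : near e (p v) y -> r y < l w.
  by case/orP => [/eqP<- //|/le_partner]; lia.
have yv_le : near e v y -> r y < l w.
  by case/orP => [/eqP<- //|/le_partner]; lia.
have := near_partner v; move: vx wy y_le yv_le; rewrite !nearE => *.
case: x_le => [x_le|eq_xv]; last by subst x; lia.
lia.
Qed.

(** [W] collects the vertices chosen from [X] on; each adds at most two vertices. Its members being
    undominated lets [next_separated] separate an earlier choice from all later ones. *)
Lemma greedy_run_card X S :
  greedy_run e r X S ->
  exists W : {set T},
    [/\ W \subset undominated e X, separated e W & #|S| <= #|X| + 2 * #|W|].
Proof.
elim=> {X S} [S _ | X v S next _ [W [Wund sepW cardS]]].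
  exists set0; split; rewrite ?sub0set ?cards0 ?addn0 //.
  by move=> v w; rewrite in_set0.
have WX : W \subset undominated e X.
  by apply/subsetP => w /(subsetP Wund); rewrite undominatedU => /andP[].
exists (v |: W); split.
- by apply/subsetP => w /setU1P[->|/(subsetP WX)//]; case: next.
- move=> a b /setU1P[->|aW] /setU1P[->|bW]; rewrite ?eqxx // => neq x y ax b_y.
  + exact: (next_separated next (subsetP Wund _ bW)).
  + rewrite (near_sym edge_sym).
    exact: (next_separated next (subsetP Wund _ aW)).
  + exact: (sepW a b).
- have vW : v \notin W by apply: contra (next_dominated X v); apply: (subsetP Wund).
  rewrite cardsU1 vW; apply: leq_trans cardS _.
  rewrite cardsU cards2; lia.
Qed.

(** Each step adds the edge [pair v] to the matching, and the stopping condition is domination. *)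
Lemma greedy_run_matching X S :
  greedy_run e r X S -> left_of_undominated X ->
  (exists M, perfect_matching e X M) ->
  dominating e S /\ exists M, perfect_matching e S M.
Proof.
elim=> {X S} [S und0 _ matchS | X v S next _ IH leftX [M /and3P[MX tM /eqP covM]]].
  by rewrite dominatingE und0.
apply: IH; first exact: left_of_undominated_step.
have [vX _] := next.
exists (M :|: [set pair v]); apply/and3P; split.
- apply/subsetP => A /setUP[/(subsetP MX)/imset2P[a b aX]|/set1P->].
    rewrite !inE => /andP[bX eab] ->; apply/imset2P.
    by exists a b; rewrite ?inE ?aX ?bX.
  apply/imset2P; exists (p v) (p (p v)); rewrite ?inE ?eqxx ?orbT //.
  exact: edge_partner.
- apply: trivIsetU => //; first exact: trivIset1.
  by rewrite covM cover1 pair_fresh.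
- by rewrite /cover bigcup_setU -!/(cover _) cover1 covM.
Qed.

Lemma left_of_undominated0 : left_of_undominated set0.
Proof. by move=> v u _; rewrite in_set0. Qed.

Lemma greedy_minimum S :
  greedy_outputs e r S -> minimum_paired_dominating e S.
Proof.
move=> run; split=> [|S' pdS'].
  have [|domS [M perfM]] := greedy_run_matching run left_of_undominated0.
    exists set0; apply/and3P; split; rewrite ?sub0set /cover ?big_set0 //.
    by rewrite /trivIset /cover !big_set0 cards0.
  by rewrite /paired_dominating domS; apply/existsP; exists M.
have [W [_ sepW cardS]] := greedy_run_card run; rewrite cards0 add0n in cardS.
exact: leq_trans cardS (separated_card edge_sym edge_irr sepW pdS').
Qed.

(** The undominated set shrinks at each step, since it loses the chosen vertex. *)
Lemma greedy_terminates X : exists S, greedy_run e r X S.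
Proof.
have [m] := ubnP #|undominated e X|; elim: m X => // m IH X ltXm.
have [und0|[w wX]] := set_0Vmem (undominated e X).
  by exists X; apply: Greedy_stop.
have [v vX min_v] := arg_minnP r wX.
have [|S run] := IH (X :|: pair v); last first.
  by exists S; apply: Greedy_step run; split.
apply: leq_trans (ltnSE ltXm); apply/proper_card/properP; split.
  by apply/subsetP => u; rewrite undominatedU => /andP[].
by exists v => //; apply: next_dominated.
Qed.

End Greedy.

(** * Endpoints in an interval model *)

Section IntervalModel.
Variables (n : nat) (e : rel 'I_n) (l r : 'I_n -> nat).
Hypothesis model : interval_model e l r.

Lemma model_lt v : l v < r v.
Proof. by case: model. Qed.

Lemma model_edgeE u v : e u v = [&& u != v, l u <= r v & l v <= r u].
Proof.
have [lt_lr _ _ edgeP] := model.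
apply/idP/and3P => [/edgeP[neq [x [[lu ru] [lv rv]]]] | [neq luv lvu]].
  split; first exact/eqP.
    by apply/leP/INR_le; apply: Rle_trans rv.
  by apply/leP/INR_le; apply: Rle_trans ru.
apply/edgeP; split; first exact/eqP.
(* Two meeting intervals share the larger of their left endpoints. *)
exists (INR (maxn (l u) (l v))); split; split; apply/le_INR/leP;
  rewrite ?leq_maxl ?leq_maxr // geq_max ?luv ?lvu ltnW //.
Qed.

Let ends := [seq l v | v <- enum 'I_n] ++ [seq r v | v <- enum 'I_n].

Lemma model_uniq : uniq ends.
Proof. by have [_ perm_ends _ _] := model; rewrite (perm_uniq perm_ends) iota_uniq. Qed.

Lemma model_l_inj : injective l.
Proof.
move=> u v; have := model_uniq; rewrite cat_uniq => /andP[/injectiveP inj_l _].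
exact: inj_l.
Qed.

Lemma model_r_inj : injective r.
Proof.
move=> u v; have := model_uniq; rewrite cat_uniq => /and3P[_ _ /injectiveP inj_r].
exact: inj_r.
Qed.

Lemma model_l_neq_r u v : l u != r v.
Proof.
have := model_uniq; rewrite cat_uniq => /and3P[_ /hasPn/= /(_ (r v)) disj _].
apply: contraTneq (map_f r (mem_enum _ v)) => eq_uv; apply/negP => /disj.
by rewrite -eq_uv map_f // mem_enum.
Qed.

Lemma model_endP x : (0 < x <= 2 * n) -> exists v, x = l v \/ x = r v.
Proof.
move=> x_range; have [_ perm_ends _ _] := model.
have: x \in ends by rewrite (perm_mem perm_ends) mem_iota add1n ltnS.
by rewrite mem_cat => /orP[]/mapP[v _ ->]; exists v; [left | right].
Qed.

Lemma model_range v : 0 < l v /\ r v <= 2 * n.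
Proof.
have [_ perm_ends _ _] := model; split.
  have: l v \in ends by rewrite mem_cat map_f ?mem_enum.
  by rewrite (perm_mem perm_ends) mem_iota => /andP[].
have: r v \in ends by rewrite mem_cat [X in _ || X]map_f ?mem_enum ?orbT.
by rewrite (perm_mem perm_ends) mem_iota add1n ltnS => /andP[].
Qed.

End IntervalModel.

(** * Cost of loop-free commands and of counted loops *)

Fixpoint loop_free (C : cmd) : bool :=
  match C with
  | Seq C1 C2 | If _ C1 C2 => loop_free C1 && loop_free C2
  | While _ _ => false
  | _ => true
  end.

Fixpoint run (C : cmd) (s : state) : state :=
  match C with
  | Assign x E => set_var s x (eval s E)
  | Store a E1 E2 => set_cell s a (eval s E1) (eval s E2)
  | Seq C1 C2 => run C2 (run C1 s)
  | If B C1 C2 => if holds s B then run C1 s else run C2 s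
  | _ => s
  end.

(** A bound independent of the state: a conditional pays for both branches. The value at [While] is
    a dummy, as in [run]. *)
Fixpoint cost (C : cmd) : nat :=
  match C with
  | Assign _ E => (exp_cost E).+1
  | Store _ E1 E2 => (exp_cost E1 + exp_cost E2).+1
  | Seq C1 C2 => cost C1 + cost C2
  | If B C1 C2 => test_cost B + (cost C1 + cost C2)
  | _ => 1
  end.

Lemma exec_loop_free C s :
  loop_free C -> exists2 t, exec C s t (run C s) & t <= cost C.
Proof.
elim: C s => [|x E|a E1 E2|C1 IH1 C2 IH2|B C1 IH1 C2 IH2|//] s /=.
- by exists 1 => //; constructor.
- by exists (exp_cost E).+1 => //; constructor.
- by exists (exp_cost E1 + exp_cost E2).+1 => //; constructor.
- case/andP=> /(IH1 s)[t1 ex1 le1] /(IH2 (run C1 s))[t2 ex2 le2].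
  by exists (t1 + t2); [apply: Exec_seq ex1 ex2 | apply: leq_add].
- case/andP=> /(IH1 s)[t1 ex1 le1] /(IH2 s)[t2 ex2 le2].
  case: ifP => [BT|/negbT BF].
    by exists (test_cost B + t1); [apply: Exec_if_true | lia].
  by exists (test_cost B + t2); [apply: Exec_if_false | lia].
Qed.

(** Rule for a loop of exactly [N] rounds, with [I k] holding after [k] of them; the last summand
    pays for the failing test. *)
Lemma exec_for (B : test) (C : cmd) (N : nat) (I : nat -> state -> Prop) s :
  loop_free C ->
  (forall k s, k < N -> I k s -> holds s B /\ I k.+1 (run C s)) ->
  (forall s, I N s -> ~~ holds s B) ->
  I 0 s ->
  exists t s', [/\ exec (While B C) s t s',
                   t <= N * (test_cost B + cost C) + test_cost B & I N s'].
Proof.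
move=> lfC step stop; rewrite -(subnn N).
(* Induction on the number [m] of rounds still to come. *)
suff loop m s1 : m <= N -> I (N - m) s1 ->
  exists t s', [/\ exec (While B C) s1 t s',
                   t <= m * (test_cost B + cost C) + test_cost B & I N s'].
  exact: loop.
elim: m s1 => [|m IH] s1 le_mN Is1.
  rewrite subn0 in Is1; exists (test_cost B), s1.
  by split=> //; apply: Exec_while_false; apply: stop.
have [|BT] := step _ s1 _ Is1; first by lia.
rewrite subnSK // => /(IH _ (ltnW le_mN))[t2 [s' [ex2 le2 Is']]].
have [t1 ex1 le1] := exec_loop_free s1 lfC.
exists (test_cost B + t1 + t2), s'; split=> //; last by rewrite mulSn; lia.
exact: Exec_while_true ex1 ex2.
Qed.

(** * The linear-time program *)

(* Variable 1 is the loop counter, variable 2 counts up to 2n, and array 3 maps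
   each endpoint to the vertex it belongs to. *)
Definition index_endpoints : cmd :=
  While (Less (Var 1) (Var 0))
    (Seq (Store 3 (Read 0 (Var 1)) (Var 1))
    (Seq (Store 3 (Read 1 (Var 1)) (Var 1))
    (Seq (Assign 1 (Succ (Var 1)))
         (Assign 2 (Succ (Succ (Var 2))))))).

(** Variable 3 receives the owner of the endpoint at position [Var 1]. The bound is [Succ (Var 2)]
    because position [2n] is included. *)
Definition sweep (at_left at_right : cmd) : cmd :=
  Seq (Assign 1 (Const 1))
  (While (Less (Var 1) (Succ (Var 2)))
    (Seq (Assign 3 (Read 3 (Var 1)))
    (Seq (If (Equal (Read 0 (Var 3)) (Var 1)) at_left at_right)
         (Assign 1 (Succ (Var 1)))))).

(* Variables 4 and 5 are the two largest right endpoints of the intervals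
   opened so far (0 if there are none). *)
Definition open_interval : cmd :=
  If (Less (Var 4) (Read 1 (Var 3)))
     (Seq (Assign 5 (Var 4)) (Assign 4 (Read 1 (Var 3))))
     (If (Less (Var 5) (Read 1 (Var 3))) (Assign 5 (Read 1 (Var 3))) Skip).

(** Array 4 stores partners. Here [Var 1] is the right endpoint of the closing vertex, which is not
    its own partner. *)
Definition find_partner : cmd :=
  If (Equal (Var 4) (Var 1))
     (Store 4 (Var 3) (Read 3 (Var 5)))
     (Store 4 (Var 3) (Read 3 (Var 4))).

(* Variable 6 is the largest right endpoint of an output vertex. *)
Definition dominate : cmd :=
  If (Less (Var 6) (Read 0 (Var 3)))
     (Seq (Store 2 (Read 4 (Var 3)) (Const 1))
     (Seq (Store 2 (Read 4 (Read 4 (Var 3))) (Const 1))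
     (Seq (Assign 6 (Read 1 (Read 4 (Var 3))))
          (If (Less (Var 6) (Read 1 (Read 4 (Read 4 (Var 3)))))
              (Assign 6 (Read 1 (Read 4 (Read 4 (Var 3)))))
              Skip))))
     Skip.

Definition greedy_cmd : cmd :=
  Seq index_endpoints
  (Seq (sweep open_interval find_partner) (sweep Skip dominate)).

(** * Correctness and running time of the program *)

Section Program.
Variables (n : nat) (e : rel 'I_n) (l r : 'I_n -> nat).
Hypothesis model : interval_model e l r.
Hypothesis noniso : no_isolated_vertex e.

Local Notation p := (partner e r).
Local Notation lt_lr := (model_lt model).
Local Notation edgeE := (model_edgeE model).
Local Notation l_inj := (model_l_inj model).
Local Notation r_inj := (model_r_inj model).

(** Established by [index_endpoints] and preserved by both sweeps. *)
Definition indexed (s : state) : Prop :=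
  [/\ vars s 2 = 2 * n,
      forall v : 'I_n, arrays s 0 v = l v,
      forall v : 'I_n, arrays s 1 v = r v,
      forall v : 'I_n, arrays s 3 (l v) = v
    & forall v : 'I_n, arrays s 3 (r v) = v].

Lemma table_ord (f : 'I_n -> nat) (v : 'I_n) : table f v = f v.
Proof. by rewrite /table valK. Qed.

Lemma exec_index_endpoints :
  exists t s,
    [/\ exec index_endpoints (input_state l r) t s, t <= n * 18 + 3, indexed s,
        [/\ vars s 4 = 0, vars s 5 = 0 & vars s 6 = 0] & forall i, arrays s 2 i = 0].
Proof.
pose I k s := [/\ vars s 0 = n /\ vars s 1 = k, vars s 2 = 2 * k,
  [/\ vars s 4 = 0, vars s 5 = 0 & vars s 6 = 0],
  (forall v : 'I_n, arrays s 0 v = l v) /\ (forall v : 'I_n, arrays s 1 v = r v) /\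
  (forall i, arrays s 2 i = 0) &
  forall v : 'I_n, v < k -> arrays s 3 (l v) = v /\ arrays s 3 (r v) = v].
have [||||t [s [ex le_t Is]]] := @exec_for (Less (Var 1) (Var 0))
  (Seq (Store 3 (Read 0 (Var 1)) (Var 1))
    (Seq (Store 3 (Read 1 (Var 1)) (Var 1))
    (Seq (Assign 1 (Succ (Var 1)))
         (Assign 2 (Succ (Succ (Var 2))))))) n I
  (input_state l r).
- by [].
- move=> k s lt_kn [[v0 v1] v2 v456 [a0 [a1 a2]] a3] /=.
  rewrite v0 v1 v2.
  have a0k : arrays s 0 k = l (Ordinal lt_kn) by exact: a0 (Ordinal _).
  have a1k : arrays s 1 k = r (Ordinal lt_kn) by exact: a1 (Ordinal _).
  rewrite a0k a1k; split=> //; split=> //=; first lia.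
  (* As endpoints are distinct, the new writes leave earlier entries intact. *)
  move=> v lt_vk; rewrite (negPf (model_l_neq_r model _ _)).
  rewrite [r v == l _]eq_sym (negPf (model_l_neq_r model _ _)) (inj_eq l_inj) (inj_eq r_inj).
  case: eqVneq => [-> //|neq_v]; apply: a3.
  by move: neq_v lt_vk; rewrite -val_eqE /=; lia.
- by move=> s [[v0 v1] _ _ _ _]; rewrite /= v0 v1 ltnn.
- by split=> //; split; [|split=> //]; apply: table_ord.
exists t, s; split=> //; have [[_ _] v2 v456 [a0 [a1 a2]] a3] := Is => //.
by split=> // v; have [] := a3 v (ltn_ord v).
Qed.

(** [J k] holds once the first [k] endpoints are handled and the counter stands at [k + 1]. *)
Lemma exec_sweep (L R : cmd) (J : nat -> state -> Prop) s :
  loop_free L -> loop_free R ->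
  (forall k s (v : 'I_n), indexed s -> vars s 1 = k.+1 -> J k s -> l v = k.+1 ->
     let s' := run L (set_var s 3 v) in
     [/\ indexed s', vars s' 1 = k.+1 & J k.+1 (set_var s' 1 k.+2)]) ->
  (forall k s (v : 'I_n), indexed s -> vars s 1 = k.+1 -> J k s -> r v = k.+1 ->
     let s' := run R (set_var s 3 v) in
     [/\ indexed s', vars s' 1 = k.+1 & J k.+1 (set_var s' 1 k.+2)]) ->
  indexed s -> J 0 (set_var s 1 1) ->
  exists t s', [/\ exec (sweep L R) s t s',
    t <= 2 * n * (cost L + cost R + 15) + 6, indexed s' & J (2 * n) s'].
Proof.
move=> lfL lfR stepL stepR idx_s J0.
pose I k s := [/\ indexed s, vars s 1 = k.+1 & J k s].
have [||||t [s' [ex le_t [idx' _ J']]]] := @exec_for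
  (Less (Var 1) (Succ (Var 2)))
  (Seq (Assign 3 (Read 3 (Var 1)))
    (Seq (If (Equal (Read 0 (Var 3)) (Var 1)) L R)
         (Assign 1 (Succ (Var 1))))) (2 * n) I (set_var s 1 1).
- by rewrite /= lfL lfR.
- move=> k s1 lt_k [idx s1_1 Jk]; have [s1_2 a0 a1 a3l a3r] := idx.
  split; first by rewrite /= s1_1 s1_2; lia.
  have [|v v_end] := @model_endP _ _ _ _ model k.+1; first by lia.
  have a3v : arrays s1 3 k.+1 = v by case: v_end => ->.
  set body := Seq _ _; have -> : run body s1 =
      let s' := run (if l v == k.+1 then L else R) (set_var s1 3 v) in
      set_var s' 1 (vars s' 1).+1.
    by rewrite /body /= s1_1 a3v a0; case: ifP.
  case: eqP => [lv|neq_lv].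
    have [idx' s'_1 J'] := stepL _ _ _ idx s1_1 Jk lv.
    by rewrite /= s'_1.
  case: v_end => [lv|rv]; first by case: neq_lv.
  have [idx' s'_1 J'] := stepR _ _ _ idx s1_1 Jk (esym rv).
  by rewrite /= s'_1.
- by move=> s1 [[s1_2 _ _ _ _] s1_1 _]; rewrite /= s1_1 s1_2; lia.
- by [].
exists (2 + t), s'; split=> //; last by move: le_t => /=; lia.
exact: Exec_seq (Exec_assign s 1 (Const 1)) ex.
Qed.

(** The interval has opened by [k]; it may already have closed. *)
Definition is_open k b := exists2 u, l u <= k & r u = b.

(** The value 0 codes an absent endpoint; the last clause rules out ties unless both are absent. *)
Definition top2 k b1 b2 :=
  [/\ forall u, l u <= k -> r u <= b2 \/ r u = b1,
      b1 = 0 \/ is_open k b1, b2 = 0 \/ is_open k b2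
    & b2 < b1 \/ (b1 = 0 /\ b2 = 0)].

Lemma top2_left k b1 b2 v : top2 k b1 b2 -> l v = k.+1 ->
  top2 k.+1 (if b1 < r v then r v else b1)
            (if b1 < r v then b1 else if b2 < r v then r v else b2).
Proof.
move=> [ub op1 op2 lt21] lv.
have le_Sk u : l u <= k.+1 -> u = v \/ l u <= k.
  rewrite leq_eqVlt => /orP[/eqP|]; last by right.
  by rewrite -lv => /l_inj; left.
have openS b : b = 0 \/ is_open k b -> b = 0 \/ is_open k.+1 b.
  by case=> [|[u lu ru]]; [left | right; exists u; [apply: leqW | ]].
have openv : is_open k.+1 (r v) by exists v; rewrite ?lv.
(* A tie would put [r v] in both places; but the owner of [b1] opened by [k], and [v] opens
   later. *)
have b1_neq : b1 != r v.
  apply/eqP => b1E; case: op1 => [|[u lu ru]]; first by have := lt_lr v; lia.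
  by have : u = v; [apply: r_inj; rewrite ru | move=> uv; subst u; lia].
have [lt1|le1] := ltnP b1 (r v); last have [lt2|le2] := ltnP b2 (r v).
all: split; auto; try lia.
all: by move=> u /le_Sk[-> | /ub]; lia.
Qed.

Lemma top2_right k b1 b2 v : top2 k b1 b2 -> r v = k.+1 -> top2 k.+1 b1 b2.
Proof.
move=> [ub op1 op2 lt21] rv.
have openS b : b = 0 \/ is_open k b -> b = 0 \/ is_open k.+1 b.
  by case=> [|[u lu ru]]; [left | right; exists u; [apply: leqW | ]].
split; auto => u; rewrite leq_eqVlt => /orP[|/ub //].
by rewrite -rv (negPf (model_l_neq_r model _ _)).
Qed.

(** [p v] meets [v], so [l v <= r (p v) <= r u] and [u] is a neighbour. Maximality gives equal right
    endpoints. *)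
Lemma partner_unique v u :
  u != v -> l u <= r v -> r (p v) <= r u -> p v = u.
Proof.
move=> neq luv le_pv; apply/r_inj/eqP; rewrite eqn_leq le_pv.
apply: le_partner; rewrite edgeE eq_sym neq luv andbT /=.
by apply: leq_trans le_pv; have := edge_partner r noniso v; rewrite edgeE => /and3P[].
Qed.

(** All neighbours of [v] have opened when [v] closes, so the largest recorded endpoint other than
    [r v] is at least [r (p v)]; [partner_unique] identifies its owner. *)
Lemma top2_partner k b1 b2 v : top2 k b1 b2 -> r v = k.+1 ->
  r (p v) = if b1 == r v then b2 else b1.
Proof.
move=> [ub op1 op2 lt21] rv.
have := edge_partner r noniso v; rewrite edgeE => /and3P[neq_pv lvp lpv].
have lpk : l (p v) <= k.
  by have := model_l_neq_r model (p v) v; move: lpv; rewrite rv; lia.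
have ub_p := ub _ lpk; have lt_lrp := lt_lr (p v); have lt_lrv := lt_lr v.
case: eqVneq => [b1E|neq].
  case: op2 => [|[u lu ru]].
    case: ub_p; first lia.
    by rewrite b1E => /r_inj eq_pv; rewrite eq_pv eqxx in neq_pv.
  have neq_uv : u != v by apply/eqP => uv; subst u; lia.
  rewrite -ru; congr r; apply: partner_unique => //; first lia.
  case: ub_p; first lia.
  by rewrite b1E => /r_inj eq_pv; rewrite eq_pv eqxx in neq_pv.
case: op1 => [|[u lu ru]]; first lia.
have neq_uv : u != v by apply/eqP => uv; subst u; lia.
by rewrite -ru; congr r; apply: partner_unique => //; lia.
Qed.

Lemma exec_find_partners s :
  indexed s -> vars s 4 = 0 -> vars s 5 = 0 -> vars s 6 = 0 ->
  (forall i, arrays s 2 i = 0) ->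
  exists t s',
    [/\ exec (sweep open_interval find_partner) s t s', t <= 2 * n * 60 + 6,
        indexed s', vars s' 6 = 0 /\ (forall i, arrays s' 2 i = 0)
      & forall v : 'I_n, arrays s' 4 v = p v].
Proof.
move=> idx v4 v5 v6 a2.
pose J k s := [/\ top2 k (vars s 4) (vars s 5), vars s 6 = 0,
  forall i, arrays s 2 i = 0 & forall v : 'I_n, r v <= k -> arrays s 4 v = p v].
have [||k s1 v idx1 v1 [top v6k a2k a4k] lv|k s1 v idx1 v1 [top v6k a2k a4k] rv|||
  t [s' [ex le_t idx' [_ v6' a2' a4]]]] := @exec_sweep open_interval find_partner J s.
- by [].
- by [].
- have [s1_2 a0 a1 a3l a3r] := idx1; have := top2_left top lv.
  have a4k' (w : 'I_n) : r w <= k.+1 -> arrays s1 4 w = p w.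
    rewrite leq_eqVlt => /orP[|/a4k //].
    by rewrite -lv eq_sym (negPf (model_l_neq_r model _ _)).
  by rewrite /= a1; case: ifP => //= _; case: ifP.
- have [s1_2 a0 a1 a3l a3r] := idx1; have := top2_partner top rv.
  have a4k' (w : 'I_n) : r w <= k.+1 ->
      (if (w : nat) == v then p v : nat else arrays s1 4 w) = p w.
    rewrite leq_eqVlt -rv (inj_eq r_inj) rv => /orP[/eqP->|/a4k ->].
      by rewrite eqxx.
    by case: eqP => // /val_inj->.
  have := top2_right top rv; rewrite /= v1 rv => top'; case: ifP => /= _ rpv;
    rewrite -rpv a3r; split=> //; split=> // w; exact: a4k'.
- by [].
- split=> //= [|u]; last by have := lt_lr u; lia.
  rewrite v4 v5; split; [|by left|by left|by right].
  by move=> u; have [] := model_range model u; lia.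
exists t, s'; split=> // [|v]; first by move: le_t => /=; lia.
apply: a4.
by case: (model_range model v).
Qed.

(** Distinct right endpoints make the next vertex unique, so every run from [X] starts with [v]. *)
Lemma greedy_run_next X S v :
  next_undominated e r X v -> greedy_run e r X S ->
  greedy_run e r (X :|: [set p v; p (p v)]) S.
Proof.
move=> [vX min_v] run; case: run vX min_v => {X S} [X und0|X w S [wX min_w] run].
  by rewrite und0 in_set0.
move=> vX min_v; suff -> : v = w by [].
by apply/r_inj/eqP; rewrite eqn_leq min_v ?min_w.
Qed.

Lemma greedy_run_stop X S :
  undominated e X = set0 -> greedy_run e r X S -> S = X.
Proof.
move=> und0 run; case: run und0 => {X S} [//|X v S [vX _] _ und0].
by rewrite und0 in_set0 in vX.
Qed.

Lemma exec_dominate S s :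
  greedy_outputs e r S -> indexed s -> vars s 6 = 0 ->
  (forall i, arrays s 2 i = 0) -> (forall v : 'I_n, arrays s 4 v = p v) ->
  exists t s',
    [/\ exec (sweep Skip dominate) s t s', t <= 2 * n * 60 + 6 & output_is s' S].
Proof.
move=> runS idx v6 a2 a4.
(* [X] is the current greedy set, from which a run still leads to [S]; variable 6 is its largest
   right endpoint, 0 if [X] is empty. *)
pose inv k s X := [/\ greedy_run e r X S, left_of_undominated e l r X,
  forall v : 'I_n, arrays s 2 v = (v \in X),
  forall v, r v <= k -> v \notin undominated e X
  & (forall u, u \in X -> r u <= vars s 6) /\
    (vars s 6 = 0 \/ exists2 u, u \in X & r u = vars s 6)].
pose J k s := (forall v : 'I_n, arrays s 4 v = p v) /\ exists X, inv k s X.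
have [||k s1 v idx1 v1 [a4k [X [run leftX a2k domX maxX]]] lv
     |k s1 v idx1 v1 [a4k [X [run leftX a2k domX [ubX attX]]]] rv|||
  t [s' [ex le_t idx' [_ [X [run _ a2' domX _]]]]]] := @exec_sweep Skip dominate J s.
- by [].
- by [].
- split=> //; split=> //; exists X; split=> // w.
  rewrite leq_eqVlt => /orP[|/domX //].
  by rewrite -lv eq_sym (negPf (model_l_neq_r model _ _)).
- have [s1_2 a0 a1 a3l a3r] := idx1; have lt_lrv := lt_lr v.
  have undE : (v \in undominated e X) = (vars s1 6 < l v).
    rewrite (undominatedE lt_lr edgeE) //; apply/forall_inP/idP => [left|ltD u uX].
      (* For the value 0 the test succeeds because left endpoints are positive. *)
      by case: attX => [->|[u /left ltu <- //]]; have [] := model_range model v.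
    exact: leq_ltn_trans (ubX u uX) ltD.
  have domS (Y : {set 'I_n}) : v \notin undominated e Y ->
      (forall w, w \in undominated e Y -> w \in undominated e X) ->
      forall w, r w <= k.+1 -> w \notin undominated e Y.
    move=> vY YX w; rewrite leq_eqVlt -rv (inj_eq r_inj) rv => /orP[/eqP-> //|/domX].
    by apply: contra; apply: YX.
  rewrite /= a0 a4k /= a4k a1; case: ifP => [ltD|geD]; last first.
    by split=> //; split=> //; exists X; split=> //; apply: domS; rewrite ?undE ?geD.
  (* Nothing that closes by [k] is undominated, so [v], closing at [k + 1], comes first. *)
  have next : next_undominated e r X v.
    split; first by rewrite undE.
    by move=> w wX; rewrite leqNgt rv ltnS; apply: contraL wX => /domX.
  set X' := X :|: [set p v; p (p v)].
  have domX' : forall w, r w <= k.+1 -> w \notin undominated e X'.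
    apply: domS; first exact: next_dominated.
    by move=> w; rewrite undominatedU => /andP[].
  have a2' (w : 'I_n) :
      (if (w : nat) == p (p v) then 1 else if (w : nat) == p v then 1
       else arrays s1 2 w) = (w \in X').
    rewrite a2k !inE (_ : ((w : nat) == p v) = (w == p v)) //.
    rewrite (_ : ((w : nat) == p (p v)) = (w == p (p v))) //.
    by case: (w \in X); case: (w == p v); case: (w == p (p v)).
  have leftX' := left_of_undominated_step lt_lr edgeE noniso leftX next.
  have run' := greedy_run_next next run.
  have ppX' : p (p v) \in X' by rewrite !inE eqxx !orbT.
  have pX' : p v \in X' by rewrite !inE eqxx !orbT.
  (* Old members end before [l v], hence before [r (p (p v))], so the old maximum may be
     overwritten. *)
  have ub' D : r (p v) <= D -> r (p (p v)) <= D -> forall u, u \in X' -> r u <= D.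
    move=> leD leD2 u /setUP[/ubX le_u|/set2P[]-> //].
    by have := le_partner2 edgeE noniso v; lia.
  case: ifP => /= lt_pp; split=> //; split=> //; exists X'; split=> //=.
  + rewrite a1 in lt_pp *; split; last by right; exists (p (p v)).
    by apply: ub' => //; apply: ltnW.
  + rewrite a1 in lt_pp; split; last by right; exists (p v).
    by apply: ub' => //; rewrite leqNgt lt_pp.
- by [].
- split=> //; exists set0; split=> //= [|v|v|].
  + exact: left_of_undominated0.
  + by rewrite in_set0.
  + by have := lt_lr v; lia.
  + by split=> [u|]; [rewrite in_set0 | left].
exists t, s'; split=> // [|v]; first by move: le_t => /=; lia.
have und0 : undominated e X = set0.
  apply/setP => u; rewrite in_set0; apply/negbTE/domX.
  by case: (model_range model u).
by rewrite (greedy_run_stop und0 run).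
Qed.

(** The three phases take at most [258 * n + 15] steps, and [0 < n] absorbs the constant. *)
Lemma exec_greedy_cmd S :
  greedy_outputs e r S -> 0 < n -> computes_within greedy_cmd l r (300 * n) S.
Proof.
move=> runS n_gt0.
have [t0 [s0 [ex0 le0 idx0 [v4 v5 v6] a2]]] := exec_index_endpoints.
have [t1 [s1 [ex1 le1 idx1 [v6' a2'] a4]]] := exec_find_partners idx0 v4 v5 v6 a2.
have [t2 [s2 [ex2 le2 out]]] := exec_dominate runS idx1 v6' a2' a4.
exists (t0 + (t1 + t2)), s2; split=> //; last by lia.
exact: Exec_seq ex0 (Exec_seq ex1 ex2).
Qed.

End Program.

Theorem theorem1 :
  (forall (n : nat) (e : rel 'I_n) (l r : 'I_n -> nat),
     3 <= n -> interval_model e l r -> no_isolated_vertex e ->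
     (exists S : {set 'I_n}, greedy_outputs e r S) /\
     (forall S : {set 'I_n},
        greedy_outputs e r S -> minimum_paired_dominating e S)) /\
  (exists (C : cmd) (c : nat),
     forall (n : nat) (e : rel 'I_n) (l r : 'I_n -> nat),
     3 <= n -> interval_model e l r -> no_isolated_vertex e ->
     forall S : {set 'I_n},
       greedy_outputs e r S -> computes_within C l r (c * n) S).

Proof.
split=> [n e l r _ model noniso|].
  have lt_lr := model_lt model; have edgeE := model_edgeE model.
  split; first exact: greedy_terminates.
  by move=> S; apply: (greedy_minimum lt_lr edgeE noniso).
exists greedy_cmd, 300 => n e l r n_ge3 model noniso S runS.
by apply: (exec_greedy_cmd model noniso runS); lia.
Qed.
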